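(* Let $M,N$ be positive integers, $h\in\mathbb{C}$, and let $\boldsymbol z=(z_1,\dots,z_N)$, $\boldsymbol\lambda=(\lambda_1,\dots,\lambda_M)$ be sequences of complex numbers. In the algebra $\mathcal{A}_h$, let $$G_h=\Big((p_u-\lambda_i)\,\delta_{ij}-\sum_{a=1}^N\frac{x_{ja}\,p_{ia}}{u-z_a}\Big)_{i,j=1}^M ,$$ let $X=(x_{ij})$ and $P=(p_{ij})$ be the $M\times N$ matrices with entries $x_{ij}$ and $p_{ij}$ ($i=1,\dots,M$, $j=1,\dots,N$), and let $Z=(z_i\delta_{ij})_{i,j=1}^N$ and $\Lambda=(\lambda_i\delta_{ij})_{i,j=1}^M$ be diagonal matrices. Then $$\prod_{a=1}^N(u-z_a)\ \mathrm{rdet}(G_h)=\mathrm{rdet}\begin{pmatrix} u-Z & X^t\\ P & p_u-\Lambda\end{pmatrix},$$ where $X^t$ is the transpose of $X$, and the matrix on the right is the $(M+N)\times(M+N)$ block matrix in which $u-Z$ and $p_u-\Lambda$ denote $u\cdot I_N-Z$ and $p_u\cdot I_M-\Lambda$.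
   Context: Row determinant: for an $n\times n$ matrix $A=(a_{ij})$ with entries in an associative (not necessarily commutative) algebra, $\mathrm{rdet}(A)=\sum_{\sigma\in S_n}\mathrm{sgn}(\sigma)\,a_{1\sigma(1)}a_{2\sigma(2)}\cdots a_{n\sigma(n)}$, where $\mathrm{sgn}(\sigma)=\pm1$ is the sign of $\sigma$. The algebra $\mathcal{A}_h$: consider variables $u,p_u,x_{ij},p_{ij}$ ($i=1,\dots,M$, $j=1,\dots,N$) such that the commutator of any two of them is zero except $[p_u,u]=h$ and $[p_{ij},x_{ij}]=h$ for all $i,j$. $\mathcal{A}_h$ is the associative unital $\mathbb{C}$-algebra whose elements are polynomials in $p_u,x_{ij},p_{ij}$ with coefficients that are rational functions in $u$ (so that $[p_u,f(u)]=h f'(u)$ for rational $f$, and rational functions of $u$ commute with all $x_{ij},p_{ij}$). *)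

(* Defs.v *)
From HB Require Import structures.
From mathcomp Require Import all_boot all_order perm all_algebra.
From mathcomp Require Import ring reals complex ssrcomplements mpoly.

Set Implicit Arguments.
Unset Strict Implicit.
Unset Printing Implicit Defensive.

Import GRing.Theory.
Local Open Scope ring_scope.

(* The factors are multiplied from left to right in increasing row order. *)
Definition rdet (R : pzRingType) (n : nat) (A : 'M[R]_n) : R :=
  \sum_(s : 'S_n) (-1) ^+ s * \prod_(i < n) A i (s i).

Section QuotientRule.
Variables (R : comPzRingType) (F : fieldType).

Lemma quot_rule_eq (p q n d p' q' n' d' : R) : p * d = n * q ->
  p' * d + p * d' = n' * q + n * q' ->
  (n' * d - n * d') * q ^+ 2 = (p' * q - p * q') * d ^+ 2.
Proof.
move=> e e'; apply/eqP; rewrite -subr_eq0; apply/eqP.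
have -> : (n' * d - n * d') * q ^+ 2 - (p' * q - p * q') * d ^+ 2
  = d * q * (n' * q + n * q' - (p' * d + p * d'))
    + (p * d - n * q) * (q' * d + q * d') by ring.
by rewrite e' e !subrr mulr0 mul0r addr0.
Qed.

Lemma div_cross (p q n d : F) : q != 0 -> d != 0 ->
  p / q = n / d -> p * d = n * q.
Proof. by move=> q0 d0 /eqP; rewrite eqr_div // => /eqP. Qed.

Lemma cross_div (p q n d : F) : q != 0 -> d != 0 ->
  p * d = n * q -> p / q = n / d.
Proof. by move=> q0 d0 e; apply/eqP; rewrite eqr_div // e. Qed.

Lemma sub_frac (n d m e : F) : d != 0 -> e != 0 ->
  n / d - m / e = (n * e - m * d) / (d * e).
Proof. by move=> d0 e0; field; apply/andP. Qed.

Lemma quot_ruleB (n d m e n' d' m' e' : F) : d != 0 -> e != 0 ->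
  ((n' * e + n * e' - (m' * d + m * d')) * (d * e)
    - (n * e - m * d) * (d' * e + d * e')) / (d * e) ^+ 2
  = (n' * d - n * d') / d ^+ 2 - (m' * e - m * e') / e ^+ 2.
Proof. by move=> d0 e0; field; apply/andP. Qed.

Lemma quot_ruleM (n d m e n' d' m' e' : F) : d != 0 -> e != 0 ->
  ((n' * m + n * m') * (d * e) - n * m * (d' * e + d * e')) / (d * e) ^+ 2
  = (n' * d - n * d') / d ^+ 2 * (m / e) + n / d * ((m' * e - m * e') / e ^+ 2).
Proof. by move=> d0 e0; field; apply/andP. Qed.

End QuotientRule.

Section RationalDerivative.
Variable C : fieldType.
Local Notation K := {fraction {poly C}}.
Local Notation "p %:F" := (@FracField.tofrac _ p).
Implicit Types (f g : K) (p q : {poly C}).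

(* The quotient rule, applied to a chosen representative of the fraction;
   [ratderE] shows that the choice is irrelevant. *)
Definition ratder f : K :=
  let n := \n_(repr f) in let d := \d_(repr f) in
  (n^`() * d - n * d^`())%:F / (d ^+ 2)%:F.

Lemma tofrac_neq0 p : p != 0 -> p%:F != 0.
Proof. by rewrite tofrac_eq0. Qed.

Lemma fracE f : f = (\n_(repr f))%:F / (\d_(repr f))%:F.
Proof.
have d0 := denom_ratioP (repr f).
apply: (mulIf (tofrac_neq0 d0)); rewrite mulfVK ?tofrac_neq0 //.
rewrite -{1}[f]reprK; move: (repr f) d0 => r d0.
unlock FracField.tofrac; rewrite -[LHS]FracField.pi_mul; apply/eqP.
rewrite FracField.equivf_def /FracField.mulf !numden_Ratio ?mulf_neq0 ?oner_neq0 //.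
by rewrite !mulr1 mulrC.
Qed.

Lemma ratderE p q : q != 0 ->
  ratder (p%:F / q%:F) = (p^`() * q - p * q^`())%:F / (q ^+ 2)%:F.
Proof.
move=> q0; rewrite /ratder; move: (fracE (p%:F / q%:F)).
move: (denom_ratioP (repr (p%:F / q%:F))).
move: (\n_(repr (p%:F / q%:F))) (\d_(repr (p%:F / q%:F))) => n d d0 e.
have {}e : p * d = n * q.
  apply/eqP; rewrite -tofrac_eq !tofracM; apply/eqP.
  exact: div_cross (tofrac_neq0 q0) (tofrac_neq0 d0) e.
have e' : p^`() * d + p * d^`() = n^`() * q + n * q^`() by rewrite -!derivM e.
apply: cross_div; [exact/tofrac_neq0/expf_neq0|exact/tofrac_neq0/expf_neq0|].
by rewrite -!tofracM; congr (_ %:F); apply: quot_rule_eq e e'.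
Qed.

Lemma ratder_poly p : ratder p%:F = (p^`())%:F.
Proof.
rewrite -[p%:F]divr1 -tofrac1 ratderE ?oner_neq0 //.
by rewrite derivC mulr0 subr0 mulr1 expr1n tofrac1 divr1.
Qed.

Fact ratder_is_zmod_morphism : zmod_morphism ratder.
Proof.
move=> f g; rewrite [f]fracE [g]fracE.
move: (denom_ratioP (repr f)) (denom_ratioP (repr g)).
move: (\n_(repr f)) (\d_(repr f)) (\n_(repr g)) (\d_(repr g)) => n d m e d0 e0.
have d0' := tofrac_neq0 d0; have e0' := tofrac_neq0 e0.
have -> : n%:F / d%:F - m%:F / e%:F = (n * e - m * d)%:F / (d * e)%:F.
  by rewrite tofracB !tofracM (sub_frac _ _ d0' e0').
rewrite (ratderE _ (mulf_neq0 d0 e0)) (ratderE _ d0) (ratderE _ e0) derivB !derivM.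
rewrite !(tofracB, tofracD, tofracM, tofracXn).
exact: quot_ruleB d0' e0'.
Qed.

HB.instance Definition _ :=
  GRing.isZmodMorphism.Build K K ratder ratder_is_zmod_morphism.

Lemma ratderM f g : ratder (f * g) = ratder f * g + f * ratder g.
Proof.
rewrite [f]fracE [g]fracE.
move: (denom_ratioP (repr f)) (denom_ratioP (repr g)).
move: (\n_(repr f)) (\d_(repr f)) (\n_(repr g)) (\d_(repr g)) => n d m e d0 e0.
have d0' := tofrac_neq0 d0; have e0' := tofrac_neq0 e0.
have -> : n%:F / d%:F * (m%:F / e%:F) = (n * m)%:F / (d * e)%:F.
  by rewrite !tofracM mulf_div.
rewrite (ratderE _ (mulf_neq0 d0 e0)) (ratderE _ d0) (ratderE _ e0) !derivM.
rewrite !(tofracB, tofracD, tofracM, tofracXn).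
exact: quot_ruleM d0' e0'.
Qed.

End RationalDerivative.

Section MapDerivation.
Variables (B : comNzRingType) (n : nat) (d : {additive B -> B}).
Hypothesis dM : forall a b, d (a * b) = d a * b + a * d b.
Implicit Types (f g : {mpoly B[n]}) (m : 'X_{1..n}).

Lemma map_addXM m g : map_mpoly d ('X_[m] * g) = 'X_[m] * map_mpoly d g.
Proof.
have dX b m' : map_mpoly d (b *: 'X_[m'] : {mpoly B[n]}) = d b *: 'X_[m'].
  apply/mpolyP => r; rewrite mcoeff_map_mpoly !mcoeffZ mcoeffX.
  by case: eqP; rewrite ?mulr1 // !mulr0 raddf0.
rewrite [g]mpolyE mulr_sumr !raddf_sum mulr_sumr; apply: eq_bigr => m' _ /=.
by rewrite dX -!scalerAr -!mpolyXD dX.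
Qed.

Lemma map_derZ b g : map_mpoly d (b *: g) = b *: map_mpoly d g + d b *: g.
Proof.
apply/mpolyP => m; rewrite mcoeffD !mcoeffZ !mcoeff_map_mpoly mcoeffZ dM.
by rewrite addrC.
Qed.

Lemma map_derM f g : map_mpoly d (f * g) = map_mpoly d f * g + f * map_mpoly d g.
Proof.
have d1 : map_mpoly d (1 : {mpoly B[n]}) = 0.
  rewrite -mpolyC1 map_mpolyC.
  have /eqP := dM 1 1; rewrite !mulr1 mul1r -subr_eq0 opprD addNKr oppr_eq0.
  by move=> /eqP ->; rewrite mpolyC0.
have dX m : map_mpoly d ('X_[m] : {mpoly B[n]}) = 0.
  by rewrite -['X_[m]]mulr1 map_addXM d1 mulr0.
elim/mpolyind: f => [|c m p _ _ IH]; first by rewrite !(mul0r, raddf0, addr0).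
rewrite !mulrDl !raddfD /= IH -scalerAl !map_derZ map_addXM dX scaler0 add0r.
by rewrite !mulrDl -!scalerAl [X in X + _ = _]addrC addrACA.
Qed.

Lemma map_mderiv i f : map_mpoly d f^`M(i) = (map_mpoly d f)^`M(i).
Proof.
by apply/mpolyP => m; rewrite mcoeff_map_mpoly !mcoeff_deriv mcoeff_map_mpoly raddfMn.
Qed.

Variable c : B.
Hypothesis dc : d c = 0.

(* The derivations c d/dx_l of B[x_0, ..., x_(n-1)], for o = Some l, and c d
   acting on coefficients, for o = None. *)
Definition polyder (o : option 'I_n) f : {mpoly B[n]} :=
  c *: (if o is Some l then f^`M(l) else map_mpoly d f).

Fact polyder_is_zmod_morphism o : zmod_morphism (polyder o).
Proof.
by move=> f g; rewrite /polyder; case: o => [l|]; rewrite raddfB scalerBr.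
Qed.

Fact polyderM o f g : polyder o (f * g) = polyder o f * g + f * polyder o g.
Proof.
rewrite /polyder -scalerAl -scalerAr -scalerDr; congr (_ *: _).
by case: o => [l|]; [exact: mderivM|exact: map_derM].
Qed.

Fact polyder_comm o o' f : polyder o (polyder o' f) = polyder o' (polyder o f).
Proof.
have dZ g : map_mpoly d (c *: g) = c *: map_mpoly d g.
  by rewrite map_derZ dc scale0r addr0.
rewrite /polyder; case: o o' => [i|] [j|]; rewrite ?mderivZ ?dZ //.
- by rewrite mderiv_comm.
- by rewrite map_mderiv.
- by rewrite map_mderiv.
Qed.

Fact polyder_cst o a : d a = 0 -> polyder o a%:MP = 0.
Proof.
move=> da; rewrite /polyder; case: o => [l|]; first by rewrite mderivC scaler0.
by rewrite map_mpolyC da mpolyC0 scaler0.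
Qed.

Lemma polyder_noneC a : polyder None a%:MP = (c * d a)%:MP.
Proof. by rewrite /polyder map_mpolyC -mul_mpolyC -mpolyCM. Qed.

Lemma polyder_someC l a : polyder (Some l) a%:MP = 0.
Proof. by rewrite /polyder mderivC scaler0. Qed.

Lemma polyder_noneX i : polyder None 'X_i = 0.
Proof.
apply/mpolyP => m; rewrite /polyder mcoeffZ mcoeff_map_mpoly mcoeffX mcoeff0.
have d1 : d 1 = 0.
  have /eqP := dM 1 1; rewrite !mulr1 mul1r -subr_eq0 opprD addNKr oppr_eq0.
  by move/eqP.
by case: eqP; rewrite /= ?d1 ?raddf0 mulr0.
Qed.

Lemma polyder_someX l i : polyder (Some l) 'X_i = (c *+ (i == l))%:MP.
Proof.
rewrite /polyder mderivX mnm1E; case: eqP => [->|_] /=.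
  have -> : (U_(l) - U_(l))%MM = 0%MM :> 'X_{1..n}.
    by apply/mnmP => j; rewrite mnmBE mnm0E subnn.
  by rewrite mpolyX0 scale1r mulr1n -mul_mpolyC mulr1.
by rewrite scale0r scaler0 mulr0n mpolyC0.
Qed.

End MapDerivation.

(* A family of n commuting derivations of a commutative ring B, together with
   a ring of constants F. *)
Record dersys (F B : comNzRingType) (n : nat) := DerSys {
  der :> 'I_n -> {additive B -> B};
  cst : {rmorphism F -> B};
  derM : forall i a b, der i (a * b) = der i a * b + a * der i b;
  der_comm : forall i j a, der i (der j a) = der j (der i a);
  der_cst : forall i c, der i (cst c) = 0
}.

(* The ring B[p_0, ..., p_(n-1)] of polynomials in n commuting momenta, written
   with the coefficients on the left, in which p_i b = b p_i + D_i b for b in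
   B. The carrier is {mpoly B[n]}; only the product differs from the commutative
   one. Left multiplication by p_i is [pact D i], so that
   (\sum_m b_m p^m) * g = \sum_m b_m (left mult. by p)^m g. *)
Definition diffop (F B : comNzRingType) (n : nat) (D : dersys F B n) : Type :=
  {mpoly B[n]}.

Section DiffOp.
Variables (F B : comNzRingType) (n : nat) (D : dersys F B n).
Local Notation S := {mpoly B[n]}.
Implicit Types (f g k : S) (m : 'X_{1..n}) (i j : 'I_n).

Definition pact i g : S := 'X_i * g + map_mpoly (D i) g.
Definition pactm m g : S :=
  foldr (fun i => iter (m i) (pact i)) g (enum 'I_n).
Definition dmul f g : S := \sum_(m <- msupp f) f@_m *: pactm m g.
Definition dscale (c : F) f : S := cst D c *: f.

Lemma derivation1 i : D i 1 = 0.
Proof. by rewrite -(rmorph1 (cst D)) der_cst. Qed.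

Fact pact_is_zmod_morphism i : zmod_morphism (pact i).
Proof. by move=> f g; rewrite /pact raddfB mulrBr opprD addrACA. Qed.
HB.instance Definition _ i :=
  GRing.isZmodMorphism.Build S S (pact i) (pact_is_zmod_morphism i).

Lemma pactZ i b g : pact i (b *: g) = b *: pact i g + D i b *: g.
Proof.
rewrite /pact -scalerAr scalerDr -addrA; congr (_ + _).
by rewrite (map_derZ (derM D i)).
Qed.

Lemma pact_comm i j g : pact i (pact j g) = pact j (pact i g).
Proof.
rewrite /pact !mulrDr !raddfD /= !map_addXM !addrA; congr (_ + _).
  by rewrite mulrCA -!addrA; congr (_ + _); rewrite addrC.
by apply/mpolyP => m; rewrite !mcoeff_map_mpoly der_comm.
Qed.

Lemma pactX i m : pact i 'X_[m] = 'X_[(U_(i) + m)%MM].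
Proof.
rewrite /pact -mpolyXD -['X_[m] in X in _ + X]mulr1 map_addXM -mpolyC1.
by rewrite map_mpolyC derivation1 mpolyC0 mulr0 addr0.
Qed.

Fact pactm_is_zmod_morphism m : zmod_morphism (pactm m).
Proof.
move=> f g; rewrite /pactm; elim: (enum _) => //= i s ->.
by elim: (m i) => //= r ->; rewrite raddfB.
Qed.
HB.instance Definition _ m :=
  GRing.isZmodMorphism.Build S S (pactm m) (pactm_is_zmod_morphism m).

Lemma pactm_pact m i g : pactm m (pact i g) = pact i (pactm m g).
Proof.
rewrite /pactm; elim: (enum _) => //= j s ->.
by elim: (m j) => //= r ->; rewrite pact_comm.
Qed.

Lemma pactm0 g : pactm 0%MM g = g.
Proof. by rewrite /pactm; elim: (enum _) => //= i s ->; rewrite mnmE. Qed.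

Lemma pactmU i m g : pactm (U_(i) + m)%MM g = pact i (pactm m g).
Proof.
rewrite /pactm.
have: uniq (enum 'I_n) := enum_uniq _; have: i \in enum 'I_n := mem_enum _ _.
elim: (enum _) => //= j s IH; rewrite inE mnmDE mnm1E => /orP[/eqP <-|si] /andP[js us].
  rewrite eqxx add1n /=; congr (pact i (iter _ _ _)).
  elim: s js {IH us} => //= l s IH; rewrite inE negb_or => /andP[il /IH ->].
  by rewrite mnmDE mnm1E (negPf il).
have /negPf -> : i != j by apply: contraNneq js => <-.
rewrite IH // add0n; elim: (m j) => //= r ->; exact: pact_comm.
Qed.

Lemma mnm_ind (P : 'X_{1..n} -> Prop) :
  P 0%MM -> (forall i m, P m -> P (U_(i) + m)%MM) -> forall m, P m.
Proof.
move=> P0 PS m; have [r] := ubnP (mdeg m); elim: r m => // r IH m mr.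
have [->//|m0] := eqVneq m 0%MM.
have [i mi] : exists i, m i != 0%N.
  apply/existsP; apply: contraNT m0; rewrite negb_exists => /forallP h.
  by apply/eqP/mnmP => i; rewrite mnmE; apply/eqP; have := h i; rewrite negbK.
have e : m = (U_(i) + (m - U_(i)))%MM.
  apply/mnmP => j; rewrite mnmDE mnmBE mnm1E.
  by case: eqP => [<-|]; rewrite ?add0n ?subn0 // subnKC // lt0n.
rewrite e; apply/PS/IH; move: mr; rewrite {1}e mdegD mdeg1 add1n ltnS.
by apply: leq_trans.
Qed.

Lemma pactmX m m' : pactm m 'X_[m'] = 'X_[(m + m')%MM].
Proof.
elim/mnm_ind: m => [|i m IH]; first by rewrite pactm0 add0m.
by rewrite pactmU IH pactX addmA.
Qed.

Lemma dmulwE d f g : (msize f <= d)%N ->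
  dmul f g = \sum_(m : 'X_{1..n < d}) f@_m *: pactm m g.
Proof.
pose I : subFinType _ := 'X_{1..n < d}.
move=> fd; rewrite /dmul (big_mksub I) /=; first last.
  by move=> x /msize_mdeg_lt/leq_trans/(_ fd).
  by rewrite msupp_uniq.
by rewrite big_rmcond //= => j /memN_msupp_eq0 ->; rewrite scale0r.
Qed.

Lemma dmulDl : left_distributive dmul +%R.
Proof.
move=> f g k; pose d := maxn (msize (f + g)) (maxn (msize f) (msize g)).
have [h1 h2 h3] : [/\ msize (f + g) <= d, msize f <= d & msize g <= d]%N.
  by rewrite /d !leq_max !leqnn !orbT.
rewrite (dmulwE _ h1) (dmulwE _ h2) (dmulwE _ h3) -big_split /=.
by apply: eq_bigr => m _; rewrite mcoeffD scalerDl.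
Qed.

Lemma dmulDr : right_distributive dmul +%R.
Proof.
move=> f g k; rewrite /dmul -big_split /=; apply: eq_bigr => m _.
by rewrite raddfD scalerDr.
Qed.

Lemma dmulZl b f g : dmul (b *: f) g = b *: dmul f g.
Proof.
pose d := maxn (msize (b *: f)) (msize f).
have [h1 h2] : (msize (b *: f) <= d)%N /\ (msize f <= d)%N.
  by rewrite /d !leq_max !leqnn !orbT.
rewrite (dmulwE _ h1) (dmulwE _ h2) scaler_sumr.
by apply: eq_bigr => m _; rewrite mcoeffZ scalerA.
Qed.

Lemma dmulXl m g : dmul 'X_[m] g = pactm m g.
Proof. by rewrite /dmul msuppX big_seq1 mcoeffX eqxx scale1r. Qed.

Lemma dmulCl b g : dmul b%:MP g = b *: g.
Proof. by rewrite -[b%:MP]mulr1 mul_mpolyC dmulZl -mpolyX0 dmulXl pactm0. Qed.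

Lemma dmul0l g : dmul 0 g = 0.
Proof. by rewrite /dmul msupp0 big_nil. Qed.

Lemma dmul_suml (I : Type) (r : seq I) (E : I -> S) g :
  dmul (\sum_(x <- r) E x) g = \sum_(x <- r) dmul (E x) g.
Proof.
by elim: r => [|x r IH]; rewrite ?big_nil ?dmul0l // !big_cons dmulDl IH.
Qed.

Lemma dmul_pact i f g : dmul (pact i f) g = pact i (dmul f g).
Proof.
rewrite [f]mpolyE raddf_sum !dmul_suml raddf_sum; apply: eq_bigr => m _ /=.
by rewrite pactZ dmulDl !dmulZl pactX !dmulXl pactmU pactZ.
Qed.

Lemma dmul_pactm m f g : dmul (pactm m f) g = pactm m (dmul f g).
Proof.
elim/mnm_ind: m => [|i m IH]; first by rewrite !pactm0.
by rewrite !pactmU dmul_pact IH.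
Qed.

Lemma dmulA : associative dmul.
Proof.
move=> f g k; rewrite {2}/dmul dmul_suml; apply: eq_bigr => m _.
by rewrite dmulZl dmul_pactm.
Qed.

Lemma dmul1l : left_id 1 dmul.
Proof. by move=> g; rewrite -mpolyX0 dmulXl pactm0. Qed.

Lemma dmul1r : right_id 1 dmul.
Proof.
move=> f; rewrite [RHS]mpolyE; apply: eq_bigr => m _.
by rewrite -mpolyX0 pactmX addm0.
Qed.

Lemma pactmZ_cst m c g : pactm m (dscale c g) = dscale c (pactm m g).
Proof.
elim/mnm_ind: m => [|i m IH]; first by rewrite !pactm0.
by rewrite !pactmU IH /dscale pactZ der_cst scale0r addr0.
Qed.

Lemma dscaleAl c f g : dscale c (dmul f g) = dmul (dscale c f) g.
Proof. by rewrite /dscale dmulZl. Qed.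

Lemma dscaleAr c f g : dscale c (dmul f g) = dmul f (dscale c g).
Proof.
rewrite /dmul /dscale scaler_sumr; apply: eq_bigr => m _.
by rewrite pactmZ_cst /dscale !scalerA mulrC.
Qed.

Lemma dscaleA a b f : dscale a (dscale b f) = dscale (a * b) f.
Proof. by rewrite /dscale scalerA rmorphM. Qed.

Lemma dscale1 : left_id 1 dscale.
Proof. by move=> f; rewrite /dscale rmorph1 scale1r. Qed.

Lemma dscaleDr : right_distributive dscale +%R.
Proof. by move=> c f g; rewrite /dscale scalerDr. Qed.

Lemma dscaleDl f : {morph dscale^~ f : a b / a + b}.
Proof. by move=> a b; rewrite /dscale rmorphD scalerDl. Qed.

HB.instance Definition _ := GRing.Zmodule.copy (diffop D) S.
HB.instance Definition _ := GRing.Zmodule_isNzRing.Build (diffop D)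
  dmulA dmul1l dmul1r dmulDl dmulDr (oner_neq0 S).
HB.instance Definition _ := GRing.Zmodule_isLmodule.Build F (diffop D)
  dscaleA dscale1 dscaleDr dscaleDl.
HB.instance Definition _ := GRing.Lmodule_isLalgebra.Build F (diffop D) dscaleAl.
HB.instance Definition _ := GRing.Lalgebra_isAlgebra.Build F (diffop D) dscaleAr.

Definition dcoef (b : B) : diffop D := b%:MP_[n].
Definition dvar (i : 'I_n) : diffop D := 'X_i : S.

Lemma diffop_mulE (f g : diffop D) : f * g = dmul f g. Proof. by []. Qed.

Lemma diffop_scaleE c (f : diffop D) : c *: f = dcoef (cst D c) * f.
Proof.
by rewrite diffop_mulE dmulCl.
Qed.

Fact dcoef_is_zmod_morphism : zmod_morphism dcoef.
Proof. by move=> a b; rewrite /dcoef raddfB. Qed.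

Fact dcoef_is_monoid_morphism : monoid_morphism dcoef.
Proof.
by split=> // a b; rewrite diffop_mulE dmulCl -mul_mpolyC -mpolyCM.
Qed.

HB.instance Definition _ :=
  GRing.isZmodMorphism.Build B (diffop D) dcoef dcoef_is_zmod_morphism.
HB.instance Definition _ :=
  GRing.isMonoidMorphism.Build B (diffop D) dcoef dcoef_is_monoid_morphism.

Lemma dvar_comm i j : dvar i * dvar j = dvar j * dvar i.
Proof. by rewrite !diffop_mulE !dmulXl !pactmX addmC. Qed.

Lemma dvar_coef i b : dvar i * dcoef b = dcoef b * dvar i + dcoef (D i b).
Proof.
rewrite !diffop_mulE dmulXl -[U_(i)%MM]addm0 pactmU pactm0 /dcoef.
by rewrite dmulCl /pact map_mpolyC mulrC mul_mpolyC.
Qed.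

Lemma dvar_coefB i b : dvar i * dcoef b - dcoef b * dvar i = dcoef (D i b).
Proof. by rewrite dvar_coef addrAC subrr add0r. Qed.

Lemma dcoef_comm a b : dcoef a * dcoef b = dcoef b * dcoef a.
Proof. by rewrite -!rmorphM mulrC. Qed.

(* The ordered monomials in the p_i form a basis over B: the coordinates of f
   are its coefficients in the carrier. *)
Lemma diffopE (f : diffop D) :
  f = \sum_(m <- msupp (f : S)) dcoef (f : S)@_m * \prod_(i < n) dvar i ^+ m i.
Proof.
pose pX m : diffop D := 'X_[m] : S.
have pXD : {morph pX : m m' / (m + m')%MM >-> m * m'}.
  by move=> m m'; rewrite diffop_mulE dmulXl pactmX.
have pX0 : pX 0%MM = 1 by rewrite /pX mpolyX0.
rewrite {1}[f]mpolyE; apply: eq_bigr => m _.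
have -> : \prod_(i < n) dvar i ^+ m i = pX m.
  rewrite [in RHS](multinomUE_id m) (big_morph pX pXD pX0).
  apply: eq_bigr => i _; elim: (m i) => [|k IH]; first by rewrite mulm0n pX0.
  by rewrite mulmS pXD exprS IH.
by rewrite diffop_mulE dmulCl.
Qed.

End DiffOp.

Section WeylAlgebra.
Variables (R : realType) (M N : nat) (h : R[i]).
Local Notation C := R[i].
Local Notation K := {fraction {poly C}}.
(* Polynomials in the M * N variables x_ij over the rational functions in u;
   mxvec_index numbers the pairs (i, j). Ah is then the ring of polynomials in
   p_u and the p_ij over B. Its defining relations are the lemmas at the end of
   the section. *)
Local Notation B := {mpoly K[M * N]}.

Definition ratcst (c : C) : K := FracField.tofrac c%:P.

Lemma ratder_cst c : ratder (ratcst c) = 0.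
Proof. by rewrite /ratcst ratder_poly derivC tofrac0. Qed.

Fact ratcst_is_zmod_morphism : zmod_morphism ratcst.
Proof. by move=> a b; rewrite /ratcst polyCB tofracB. Qed.
Fact ratcst_is_monoid_morphism : monoid_morphism ratcst.
Proof. by split=> [|a b]; rewrite /ratcst ?polyCM (tofrac1, tofracM). Qed.
HB.instance Definition _ :=
  GRing.isZmodMorphism.Build C K ratcst ratcst_is_zmod_morphism.
HB.instance Definition _ :=
  GRing.isMonoidMorphism.Build C K ratcst ratcst_is_monoid_morphism.

Definition Ah_cst : {rmorphism C -> B} := @mpolyC (M * N) K \o ratcst.

(* Index 0 is for p_u, which acts on coefficients as h d/du; the others are for
   the p_ij, which act as h d/dx_ij. *)
Definition Ah_der (k : 'I_(M * N).+1) : B -> B :=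
  polyder (@ratder C) (ratcst h) (unlift ord0 k).

Fact Ah_der_is_zmod_morphism k : zmod_morphism (Ah_der k).
Proof. exact: polyder_is_zmod_morphism. Qed.
HB.instance Definition _ k :=
  GRing.isZmodMorphism.Build B B (Ah_der k) (Ah_der_is_zmod_morphism k).

Fact Ah_derM k f g : Ah_der k (f * g) = Ah_der k f * g + f * Ah_der k g.
Proof. exact: (polyderM (@ratderM C)). Qed.

Fact Ah_der_comm k l f : Ah_der k (Ah_der l f) = Ah_der l (Ah_der k f).
Proof. exact: (polyder_comm (@ratderM C) (ratder_cst h)). Qed.

Fact Ah_der_cst k c : Ah_der k (Ah_cst c) = 0.
Proof. exact: (polyder_cst _ _ (ratder_cst c)). Qed.

Definition Ah_sys : dersys C B (M * N).+1 :=
  @DerSys C B _ Ah_der Ah_cst Ah_derM Ah_der_comm Ah_der_cst.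

Definition Ah : algType C := diffop Ah_sys.

Definition Ah_rat (f : K) : Ah := dcoef Ah_sys f%:MP.
Definition Ah_u : Ah := Ah_rat (FracField.tofrac 'X).
Definition Ah_pu : Ah := dvar Ah_sys ord0.
Definition Ah_x (i : 'I_M) (j : 'I_N) : Ah := dcoef Ah_sys 'X_(mxvec_index i j).
Definition Ah_p (i : 'I_M) (j : 'I_N) : Ah :=
  dvar Ah_sys (lift ord0 (mxvec_index i j)).

Fact Ah_rat_is_zmod_morphism : zmod_morphism Ah_rat.
Proof. by move=> f g; rewrite /Ah_rat !raddfB. Qed.
Fact Ah_rat_is_monoid_morphism : monoid_morphism Ah_rat.
Proof.
split; first by rewrite /Ah_rat !rmorph1.
by move=> f g; rewrite /Ah_rat !rmorphM.
Qed.
HB.instance Definition _ :=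
  GRing.isZmodMorphism.Build K Ah Ah_rat Ah_rat_is_zmod_morphism.
HB.instance Definition _ :=
  GRing.isMonoidMorphism.Build K Ah Ah_rat Ah_rat_is_monoid_morphism.

Lemma Ah_ratcst c : Ah_rat (ratcst c) = c%:A.
Proof. by rewrite [RHS]diffop_scaleE mulr1. Qed.

Lemma Ah_pu_rat f : Ah_pu * Ah_rat f - Ah_rat f * Ah_pu = h *: Ah_rat (ratder f).
Proof.
rewrite [LHS]dvar_coefB [RHS]diffop_scaleE -rmorphM; congr (dcoef _ _).
by rewrite /= /Ah_der unlift_none polyder_noneC mpolyCM.
Qed.

Lemma Ah_pu_u : Ah_pu * Ah_u - Ah_u * Ah_pu = h%:A.
Proof. by rewrite Ah_pu_rat ratder_poly derivX tofrac1 rmorph1. Qed.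

Lemma Ah_pu_x i j : Ah_pu * Ah_x i j = Ah_x i j * Ah_pu.
Proof.
apply/eqP; rewrite -subr_eq0 [X in X == _]dvar_coefB /= /Ah_der unlift_none.
by rewrite (polyder_noneX (@ratderM C)) rmorph0.
Qed.

Lemma Ah_p_x i j k l :
  Ah_p i j * Ah_x k l - Ah_x k l * Ah_p i j = h%:A *+ ((i == k) && (j == l)).
Proof.
rewrite [LHS]dvar_coefB -Ah_ratcst -raddfMn; congr (dcoef _ _).
rewrite /= /Ah_der liftK polyder_someX /mxvec_index.
rewrite (inj_eq (@cast_ord_inj _ _ _)) (inj_eq enum_rank_inj) xpair_eqE.
by rewrite [k == i]eq_sym [l == j]eq_sym.
Qed.

Lemma Ah_p_rat i j f : Ah_p i j * Ah_rat f = Ah_rat f * Ah_p i j.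
Proof.
apply/eqP; rewrite -subr_eq0 [X in X == _]dvar_coefB /= /Ah_der liftK.
by rewrite polyder_someC rmorph0.
Qed.

Lemma Ah_p_pu i j : Ah_p i j * Ah_pu = Ah_pu * Ah_p i j.
Proof. exact: dvar_comm. Qed.

Lemma Ah_p_p i j k l : Ah_p i j * Ah_p k l = Ah_p k l * Ah_p i j.
Proof. exact: dvar_comm. Qed.

Lemma Ah_x_rat i j f : Ah_x i j * Ah_rat f = Ah_rat f * Ah_x i j.
Proof. exact: dcoef_comm. Qed.

Lemma Ah_x_x i j k l : Ah_x i j * Ah_x k l = Ah_x k l * Ah_x i j.
Proof. exact: dcoef_comm. Qed.

End WeylAlgebra.

(* Main.v *)
Require Import Defs.
From mathcomp Require Import all_boot all_order perm all_algebra.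
From mathcomp Require Import reals complex.
From HB Require Import structures.
From mathcomp Require Import ring mpoly.

Set Implicit Arguments.
Unset Strict Implicit.
Unset Printing Implicit Defensive.

Import GRing.Theory.
Local Open Scope ring_scope.

(** Both sides are normally ordered determinants, so the identity reduces to the
Schur complement formula over a commutative ring.

Writing every element of A_h with the coefficients (functions of u and of the
x_ij) to the left of the momenta identifies the vector space A_h with the
commutative polynomial ring S in the momenta over the coefficients. Let nord be
this linear bijection from S to A_h. If f in S has degree at most one in the
momenta, then nord f * nord e = nord (f e + d e), where d is the derivation by
which the momenta in f act on coefficients: one single contraction, and no higher
ones. This relation is [wick].

Lemma [rdet_nord] tells when a row determinant of such elements is just the
normally ordered commutative determinant. Multiplying out the rows from the bottom
up, the row k meets the product of the rows below it and gives, beside the normally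
ordered product, one contraction d_(k,s(k)) (g_(l,s(l))) for each l > k. If these
are symmetric under the exchange of the columns s(k) and s(l), then the
permutations s and s o (k l), of opposite signs, cancel them.

For the block matrix all contractions between a row and a lower one vanish: the
upper rows contain no momentum, and the lower rows contain no variable on which a
momentum acts. For G_h they do not vanish, but with
e_j = h sum_a x_ja p_ka / (u - z_a)^2 the contraction of the entry (i, j) with the
entry (k, l) below it is delta_ij e_l + delta_il e_j: the first term comes from
p_u acting on 1 / (u - z_a), the second from p_ia acting on x_la. This is
symmetric in j and l ([rdet_schur_symbol]).

So both row determinants are normally ordered determinants over S, where
p_u - Lambda - P (u - Z)^-1 X^t is the Schur complement of u - Z in the block
matrix ([det_schur]). The factor prod_a (u - z_a) is a coefficient and stands on
the left, so that it can be taken inside the normal ordering. *)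

(** * Alternating sums and the product rule *)

(** The permutations s and (i k) s have opposite signs, so that their terms cancel.
Pairing them, rather than comparing the sum with its opposite, avoids dividing
by 2. *)
Lemma alternating_sum0 (V : pzRingType) n (i k : 'I_n) (E : 'S_n -> V) :
  i != k -> (forall s, E (tperm i k * s)%g = E s) ->
  \sum_(s : 'S_n) (-1) ^+ s * E s = 0.
Proof.
move=> ik Et; rewrite (bigID (@odd_perm _)) /=.
rewrite [X in X + _](reindex_inj (mulgI (tperm i k))) /=.
rewrite [X in X + _](eq_bigl (fun s : 'S_n => ~~ odd_perm s)); last first.
  by move=> s; rewrite odd_permM odd_tperm ik.
rewrite -big_split big1 // => s /negPf so /=.
by rewrite odd_permM odd_tperm ik so Et mulN1r mul1r addNr.
Qed.

Lemma derivation_prod (S : comPzRingType) (d : S -> S) (I : eqType)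
    (r : seq I) (E : I -> S) :
  (forall a b, d (a * b) = d a * b + a * d b) -> uniq r ->
  d (\prod_(i <- r) E i)
  = \sum_(l <- r) d (E l) * \prod_(i <- r | i != l) E i.
Proof.
move=> dM; elim: r => [_|x r IH /= /andP[xr ur]].
  rewrite !big_nil; have /eqP := dM 1 1.
  by rewrite !mulr1 mul1r -subr_eq0 opprD addNKr oppr_eq0 => /eqP.
rewrite !big_cons dM IH // eqxx /=; congr (_ * _ + _).
  rewrite big_seq [RHS]big_seq_cond; apply: eq_bigl => i.
  by case: eqP => [->|_]; rewrite ?(negPf xr) // andbT.
rewrite mulr_sumr; apply: eq_big_seq => l lr.
rewrite big_cons; case: eqP => [e|_]; first by rewrite e lr in xr.
by rewrite mulrCA.
Qed.

(** * Normal ordering and row determinants *)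

Section NormalOrdering.
Variables (A : pzRingType) (S : comPzRingType) (nord : {additive S -> A}).
Hypothesis nord1 : nord 1 = 1.

(** Wick's theorem for a left factor f of degree at most one in the momenta: f is
contracted at most once with the right factor, and d is this contraction. *)
Definition wick (f : S) (d : S -> S) :=
  (forall a b, d (a * b) = d a * b + a * d b) /\
  (forall e, nord f * nord e = nord (f * e + d e)).

Lemma wickD f1 f2 d1 d2 : wick f1 d1 -> wick f2 d2 ->
  wick (f1 + f2) (fun e => d1 e + d2 e).
Proof.
case=> [d1M w1] [d2M w2]; split=> [a b|e]; first by rewrite d1M d2M; ring.
by rewrite raddfD mulrDl w1 w2 -raddfD; congr (nord _); ring.
Qed.

Lemma wick0 : wick 0 (fun=> 0).
Proof. by split=> [a b|e]; rewrite ?raddf0 ?mul0r ?mulr0 addr0 ?raddf0. Qed.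

Lemma wickN f d : wick f d -> wick (- f) (fun e => - d e).
Proof.
case=> [dM w]; split=> [a b|e]; first by rewrite dM; ring.
by rewrite raddfN mulNr w -raddfN; congr (nord _); ring.
Qed.

Lemma wick_mull c f d : wick c (fun=> 0) -> wick f d ->
  wick (c * f) (fun e => c * d e).
Proof.
case=> _ wc [dM w]; have {}wc e : nord c * nord e = nord (c * e).
  by rewrite wc addr0.
split=> [a b|e]; first by rewrite dM; ring.
by rewrite -wc -mulrA w wc mulrDr mulrA.
Qed.

Lemma wick_mulrb f d (b : bool) : wick f d -> wick (f *+ b) (fun e => d e *+ b).
Proof. by case: b => // _; exact: wick0. Qed.

Lemma wick_sum (I : Type) (r : seq I) (f : I -> S) (d : I -> S -> S) :
  (forall i, wick (f i) (d i)) ->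
  wick (\sum_(i <- r) f i) (fun e => \sum_(i <- r) d i e).
Proof.
move=> w; elim: r => [|i r [IHM IH]].
  by rewrite big_nil; split=> [a b|e]; rewrite !big_nil;
    [case: wick0 => + _; apply | case: wick0 => _; apply].
have [dM wM] := wickD (w i) (conj IHM IH).
by split=> [a b|e]; rewrite !big_cons; [apply: dM | apply: wM].
Qed.

(** The contractions of a row i with a lower row k cancel between the permutations
that differ by exchanging the columns j and l of these two rows. *)
Lemma rdet_nord n (g : 'M[S]_n) (d : 'I_n -> 'I_n -> S -> S) :
  (forall i j, wick (g i j) (d i j)) ->
  (forall i k j l : 'I_n, (i < k)%N -> d i j (g k l) = d i l (g k j)) ->
  rdet (map_mx nord g) = nord (\det g).
Proof.
move=> w dsym.
pose lt_ord (i k : 'I_n) := (i < k)%N.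
have lt_ordxx : irreflexive lt_ord by move=> i; exact: ltnn.
(* The rows in r1 are still multiplied in A, those in r2 already in S. *)
pose V r1 r2 := \sum_(s : 'S_n) (-1) ^+ s *
  ((\prod_(i <- r1) nord (g i (s i))) * nord (\prod_(i <- r2) g i (s i))).
have step r1 k r2 : pairwise lt_ord (r1 ++ k :: r2) ->
    V (rcons r1 k) r2 = V r1 (k :: r2).
  rewrite pairwise_cat allrel_consr /= => /and4P[/andP[/allP r1k _] _].
  move=> /allP kr2 /(pairwise_uniq lt_ordxx) ur2; rewrite /V.
  under eq_bigr => s _.
    rewrite big_rcons -mulrA (proj2 (w _ _)) raddfD !mulrDr.
    rewrite (derivation_prod _ (proj1 (w _ _)) ur2) raddf_sum !mulr_sumr.
    over.
  (* The second summand collects the contractions of the row k with the rows l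
     in r2; each l contributes an alternating sum that vanishes. *)
  rewrite big_split /= [X in _ + X]exchange_big /= [X in _ + X]big_seq.
  rewrite [X in _ + X]big1 => [|l lr].
    by rewrite addr0; apply: eq_bigr => s _; rewrite big_cons.
  have kl : (k < l)%N := kr2 l lr.
  apply: (@alternating_sum0 _ _ k l) => [|s]; first by rewrite neq_ltn kl.
  congr (_ * nord (_ * _)).
  - apply: eq_big_seq => i ir.
    have ik : (i < k)%N := r1k i ir.
    by rewrite permM tpermD // neq_ltn ?ik ?(ltn_trans ik kl) orbT.
  - by rewrite !permM tpermL tpermR; exact: dsym.
  - rewrite big_seq_cond [RHS]big_seq_cond; apply: eq_bigr => i /andP[ir il].
    have ki : (k < i)%N := kr2 i ir.
    by rewrite permM tpermD // 1?eq_sym // neq_ltn ki ?orbT.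
have run r2 r1 : pairwise lt_ord (r1 ++ r2) -> V (r1 ++ r2) [::] = V r1 r2.
  elim: r2 r1 => [|k r2 IH] r1 pr; first by rewrite cats0.
  by rewrite -step // -cat_rcons IH // cat_rcons.
have le : pairwise lt_ord (index_enum 'I_n).
  rewrite -(pairwise_map val ltn) [index_enum _]unlock -enumT val_enum_ord.
  by rewrite -(sorted_pairwise ltn_trans) iota_ltn_sorted.
transitivity (V (index_enum 'I_n) [::]).
  apply: eq_bigr => s _; rewrite big_nil nord1 mulr1; congr (_ * _).
  by apply: eq_bigr => i _; rewrite mxE.
rewrite (run _ [::] le) raddf_sum; apply: eq_bigr => s _.
by rewrite big_nil mul1r; case: (odd_perm s); rewrite ?mulN1r ?raddfN // !mul1r.
Qed.

End NormalOrdering.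

(** * The Schur complement over a commutative ring *)

(** Right multiplication by a unipotent block matrix clears the upper right block. *)
Lemma det_schur (S : comPzRingType) m n (D W : 'M[S]_m) (E : 'M_(m, n))
    (P : 'M_(n, m)) (Q : 'M_n) : D *m W = 1%:M ->
  \det (block_mx D E P Q) = \det D * \det (Q - P *m W *m E).
Proof.
move=> DW; pose U : 'M[S]_(m + n) := block_mx 1%:M (- (W *m E)) 0 1%:M.
have <- : \det (block_mx D E P Q *m U) = \det (block_mx D E P Q).
  by rewrite det_mulmx det_ublock !det1 !mulr1.
rewrite mulmx_block !mulmx1 !mulmx0 !addr0 !mulmxN !mulmxA DW mul1mx addNr.
by rewrite det_lblock addrC.
Qed.

(** * Normal ordering of differential operators *)

Section DiffOp.
Variables (F B : comNzRingType) (n : nat) (D : dersys F B n).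

(** A differential operator is stored as its normally ordered symbol, so that normal
ordering is the identity map between two different ring structures. *)
Definition nord (f : {mpoly B[n]}) : diffop D := f.

Fact nord_is_zmod_morphism : zmod_morphism nord.
Proof. by []. Qed.
HB.instance Definition _ :=
  GRing.isZmodMorphism.Build {mpoly B[n]} (diffop D) nord nord_is_zmod_morphism.

Lemma nord1 : nord 1 = 1.
Proof. by []. Qed.

Lemma wick_coef b : wick nord b%:MP (fun=> 0).
Proof.
split=> [f g|g]; first by rewrite mul0r mulr0 addr0.
by rewrite diffop_mulE dmulCl addr0 mul_mpolyC.
Qed.

Lemma wick_var i : wick nord 'X_i (map_mpoly (D i)).
Proof.
split=> [f g|g]; first exact: (map_derM (derM D i)).
by have := pactmU D i 0%MM g; rewrite addm0 pactm0 diffop_mulE dmulXl => ->.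
Qed.

Lemma map_der_coefM i b (f : {mpoly B[n]}) :
  map_mpoly (D i) (b%:MP * f) = (D i b)%:MP * f + b%:MP * map_mpoly (D i) f.
Proof. by rewrite (map_derM (derM D i)) map_mpolyC. Qed.

Lemma map_der_var i j : map_mpoly (D i) ('X_j : {mpoly B[n]}) = 0.
Proof.
rewrite -['X_j]mulr1 (map_addXM (D i)) -mpolyC1 map_mpolyC derivation1.
by rewrite mpolyC0 mulr0.
Qed.

End DiffOp.

(** * Row determinants of Schur complements with momenta *)

Section MomentumSchurComplement.
Variables (F B : comNzRingType) (n : nat) (D : dersys F B n) (M N : nat).
Variables (o : 'I_n) (q : 'I_M -> 'I_N -> 'I_n) (hb : B).
Variables (x : 'I_M -> 'I_N -> B) (v w : 'I_N -> B) (lam : 'I_M -> B).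
(* The index o is that of p_u, q i a that of p_ia, and v a and w a stand for
   u - z_a and its inverse. *)
Hypothesis vw : forall a, v a * w a = 1.
Hypothesis der_lam : forall k i, D k (lam i) = 0.
Hypothesis der_o_x : forall i a, D o (x i a) = 0.
Hypothesis der_o_w : forall a, D o (w a) = - (hb * w a ^+ 2).
Hypothesis der_q_x : forall i a k b,
  D (q i a) (x k b) = hb *+ ((i == k) && (a == b)).
Hypothesis der_q_w : forall i a b, D (q i a) (w b) = 0.
Local Notation S := {mpoly B[n]}.

Definition diag_symbol i : S := 'X_o - (lam i)%:MP.
Definition schur_symbol : 'M[S]_M := \matrix_(i, j)
  (diag_symbol i *+ (i == j) - \sum_a (x j a * w a)%:MP * 'X_(q i a)).
Definition block_symbol : 'M[S]_(N + M) :=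
  block_mx (diag_mx (\row_a (v a)%:MP)) (\matrix_(i, a) (x i a)%:MP)^T
    (\matrix_(i, a) 'X_(q i a)) (diag_mx (\row_i diag_symbol i)).

Lemma det_block_symbol : \det block_symbol = (\prod_a (v a)%:MP) * \det schur_symbol.
Proof.
rewrite /block_symbol (@det_schur _ _ _ _ (diag_mx (\row_a (w a)%:MP))).
  rewrite det_diag; under eq_bigr do rewrite mxE.
  set G := (X in \det X); suff -> : G = schur_symbol by [].
  apply/matrixP => i j; rewrite !mxE; congr (_ - _); apply: eq_bigr => a _.
  by rewrite mul_mx_diag !mxE mpolyCM mulrC mulrA mulrAC.
rewrite mulmx_diag; apply/matrixP => i j; rewrite !mxE.
by rewrite -mpolyCM vw.
Qed.

Lemma wick_diag i : wick (nord D) (diag_symbol i) (map_mpoly (D o)).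
Proof.
have [oM wo] := wick_var D o; split=> // e.
by rewrite (wickD (conj oM wo) (wickN (wick_coef D (lam i)))).2 subr0.
Qed.

Lemma map_der_diag k i : map_mpoly (D k) (diag_symbol i) = 0.
Proof. by rewrite raddfB /= map_der_var map_mpolyC der_lam mpolyC0 subr0. Qed.

(** No entry of a lower row has a nonzero contraction with a later row, since
later rows only contain momenta and constants. *)
Lemma rdet_block_symbol :
  rdet (map_mx (nord D) block_symbol) = nord D (\det block_symbol).
Proof.
pose d (i j : 'I_(N + M)) : S -> S :=
  match split i, split j with
  | inl _, _ => fun=> 0
  | inr k, inl a => map_mpoly (D (q k a))
  | inr k, inr l => fun e => (map_mpoly (D o) e) *+ (k == l)
  end.
apply: (@rdet_nord _ _ _ (nord1 D) _ _ d) => [i j|i k j l ik].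
  rewrite /d /block_symbol !mxE.
  case: (split i) => a; rewrite !mxE; case: (split j) => b; rewrite !mxE.
  - by rewrite -raddfMn; exact: wick_coef.
  - exact: wick_coef.
  - exact: wick_var.
  - exact: wick_mulrb (wick_diag _).
rewrite /d /block_symbol !mxE; case: (splitP i) => [//|i' ei].
case: (splitP k) => [k' ek|k' _]; last first.
  rewrite !mxE; case: (split j) => a; case: (split l) => b; rewrite !mxE;
    by rewrite ?raddfMn /= ?map_der_diag ?map_der_var ?mul0rn.
by have := ltn_ord k'; rewrite -ek ltnNge (leq_trans (leq_addr i' N)) // -ei ltnW.
Qed.

Lemma map_der_schur_symbol t k l : map_mpoly (D t) (schur_symbol k l)
  = - \sum_a (D t (x l a * w a))%:MP * 'X_(q k a).
Proof.
rewrite mxE raddfB raddfMn /= map_der_diag mul0rn sub0r; congr (- _).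
rewrite raddf_sum; apply: eq_bigr => a _; rewrite /= map_der_coefM.
by rewrite map_der_var mulr0 addr0.
Qed.

(** The contraction of the entries (i, j) and (k, l) is symmetric in j and l: p_u
acting on the poles of G_kl gives a term at i = j, and the p_ia acting on its x_la
give the same expression, with j and l exchanged, at i = l. The two agree because
the derivative of w a is - hb (w a)^2. *)
Lemma rdet_schur_symbol :
  rdet (map_mx (nord D) schur_symbol) = nord D (\det schur_symbol).
Proof.
pose d i j e : S := (map_mpoly (D o) e) *+ (i == j)
  - \sum_a (x j a * w a)%:MP * map_mpoly (D (q i a)) e.
apply: (@rdet_nord _ _ _ (nord1 D) _ _ d) => [i j|i k j l _].
  rewrite mxE; apply: wickD; first exact: wick_mulrb (wick_diag i).
  apply/wickN/wick_sum => a; apply: wick_mull; first exact: wick_coef.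
  exact: wick_var.
(* In both terms two minus signs cancel: at i = j that of the derivative of w and
   that of the sum in G_kl, at i = l those of the sums in G_ij and G_kl. *)
pose e j : S := \sum_a (hb * x j a * w a ^+ 2)%:MP * 'X_(q k a).
have dE j' l' : d i j' (schur_symbol k l') = e l' *+ (i == j') + e j' *+ (i == l').
  rewrite /d map_der_schur_symbol; congr (_ *+ _ + _).
    rewrite -sumrN; apply: eq_bigr => a _; rewrite derM der_o_x der_o_w.
    by rewrite mul0r add0r mulrN mpolyCN mulNr opprK; congr (_%:MP * _); ring.
  rewrite -sumrN -sumrMnl; apply: eq_bigr => a _.
  rewrite map_der_schur_symbol mulrN opprK (bigD1 a) //= big1 => [|b ba].
    rewrite addr0 derM der_q_w mulr0 addr0 der_q_x eqxx andbT mulrnAl mulrA.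
    by rewrite -mpolyCM mulrnAr raddfMn /= mulrnAl; congr (_%:MP * _ *+ _); ring.
  rewrite derM der_q_w mulr0 addr0 der_q_x [a == b]eq_sym (negPf ba) andbF mul0r.
  by rewrite mpolyC0 mul0r.
by rewrite !dE addrC.
Qed.

Lemma nord_schur_symbol i j : nord D (schur_symbol i j)
  = (dvar D o - dcoef D (lam i)) *+ (i == j)
    - \sum_a dcoef D (x j a) * dvar D (q i a) * dcoef D (w a).
Proof.
rewrite mxE raddfB raddfMn raddfB; congr (_ - _).
rewrite raddf_sum; apply: eq_bigr => a _ /=.
have [_ wick_xw] := wick_coef D (x j a * w a).
rewrite -[X in nord D X]addr0 -wick_xw -mulrA dvar_coef der_q_w rmorph0 addr0.
by rewrite mulrA -rmorphM.
Qed.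

Lemma nord_block_symbol : map_mx (nord D) block_symbol
  = block_mx (diag_mx (\row_a dcoef D (v a))) (\matrix_(i, a) dcoef D (x i a))^T
      (\matrix_(i, a) dvar D (q i a))
      (diag_mx (\row_i (dvar D o - dcoef D (lam i)))).
Proof.
by rewrite map_block_mx; congr block_mx; apply/matrixP => i j; rewrite !mxE.
Qed.

Lemma rdet_schur :
  (\prod_a dcoef D (v a)) * rdet (\matrix_(i, j)
     ((dvar D o - dcoef D (lam i)) *+ (i == j)
      - \sum_a dcoef D (x j a) * dvar D (q i a) * dcoef D (w a)))
  = rdet (block_mx (diag_mx (\row_a dcoef D (v a)))
      (\matrix_(i, a) dcoef D (x i a))^T (\matrix_(i, a) dvar D (q i a))
      (diag_mx (\row_i (dvar D o - dcoef D (lam i))))).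
Proof.
rewrite -nord_block_symbol rdet_block_symbol det_block_symbol -!rmorph_prod.
transitivity (dcoef D (\prod_a v a) * rdet (map_mx (nord D) schur_symbol)).
  congr (_ * rdet _); apply/matrixP => i j.
  by rewrite [RHS]mxE nord_schur_symbol mxE.
by rewrite rdet_schur_symbol; have [_ ->] := wick_coef D (\prod_a v a); rewrite addr0.
Qed.

End MomentumSchurComplement.

(** * The algebra A_h *)

Section Ah.
Variables (R : realType) (M N : nat) (h : R[i]).
Local Notation K := {fraction {poly R[i]}}.
Local Notation B := {mpoly K[M * N]}.
Local Notation D := (Ah_sys M N h).

Definition ratXsubC (c : R[i]) : K := FracField.tofrac ('X - c%:P).

Lemma ratXsubC_neq0 c : ratXsubC c != 0.
Proof. by rewrite tofrac_eq0 polyXsubC_eq0. Qed.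

Lemma ratder_XsubCV c : ratder (ratXsubC c)^-1 = - (ratXsubC c)^-1 ^+ 2.
Proof.
have p0 := ratXsubC_neq0 c; apply: (mulIf p0).
have := ratderM (ratXsubC c)^-1 (ratXsubC c); rewrite mulVf //.
rewrite -[1]tofrac1 !ratder_poly derivXsubC -polyC1 derivC tofrac0 tofrac1.
by rewrite mulr1 expr2 mulNr mulfVK // => /esym/eqP; rewrite addr_eq0 => /eqP.
Qed.

Lemma der_pu_x i a : D ord0 'X_(mxvec_index i a) = 0.
Proof. by rewrite /= /Ah_der unlift_none (polyder_noneX (@ratderM _)). Qed.

Lemma der_pu_XsubCV c :
  D ord0 (ratXsubC c)^-1%:MP = - (Ah_cst R M N h * (ratXsubC c)^-1%:MP ^+ 2).
Proof.
rewrite /= /Ah_der unlift_none polyder_noneC [X in _ * X]ratder_XsubCV mulrN.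
by rewrite mpolyCN mpolyCM !expr2 [in LHS]mpolyCM.
Qed.

Lemma der_p_x i a k b :
  D (lift ord0 (mxvec_index i a)) 'X_(mxvec_index k b)
  = Ah_cst R M N h *+ ((i == k) && (a == b)).
Proof.
rewrite /= /Ah_der liftK polyder_someX /mxvec_index raddfMn.
rewrite (inj_eq (@cast_ord_inj _ _ _)) (inj_eq enum_rank_inj) xpair_eqE.
by rewrite [k == i]eq_sym [b == a]eq_sym.
Qed.

Lemma der_p_rat i a (f : K) : D (lift ord0 (mxvec_index i a)) f%:MP = 0.
Proof. by rewrite /= /Ah_der liftK polyder_someC. Qed.

Lemma ratXsubC_mulV c : (ratXsubC c)%:MP * (ratXsubC c)^-1%:MP = 1 :> B.
Proof. by rewrite -mpolyCM mulfV ?ratXsubC_neq0. Qed.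

(** The type ascription makes sums and differences of coefficients use the algebra
structure of A_h itself, not that of the underlying ring of operators. *)
Definition Ah_coef (b : B) : Ah M N h := dcoef D b.

Lemma Ah_uB c : Ah_u M N h - c%:A = Ah_coef (ratXsubC c)%:MP.
Proof. by rewrite -Ah_ratcst -raddfB /ratXsubC tofracB. Qed.

End Ah.

Theorem corollary2p2 (R : realType) (M N : nat) (h : R[i])
    (z : 'I_N -> R[i]) (lambda : 'I_M -> R[i])
    (M_gt0 : (0 < M)%N) (N_gt0 : (0 < N)%N) :
  let u : Ah M N h := Ah_u M N h in
  let pu : Ah M N h := Ah_pu M N h in
  let X : 'M[Ah M N h]_(M, N) := \matrix_(i, j) Ah_x h i j in
  let P : 'M[Ah M N h]_(M, N) := \matrix_(i, j) Ah_p h i j in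
  let Z : 'M[Ah M N h]_N := diag_mx (\row_a (z a)%:A) in
  let Lambda : 'M[Ah M N h]_M := diag_mx (\row_i (lambda i)%:A) in
  let G : 'M[Ah M N h]_M := \matrix_(i, j)
    ((pu - (lambda i)%:A) *+ (i == j)
     - \sum_(a < N) X j a * P i a
         * Ah_rat M N h (FracField.tofrac ('X - (z a)%:P))^-1) in
  (\prod_(a < N) (u - (z a)%:A)) * rdet G
  = rdet (block_mx (u%:M - Z) X^T P (pu%:M - Lambda)).
Proof.
move=> u pu X P Z Lambda G.
have coef c : c%:A = Ah_coef h (Ah_cst R M N c) by rewrite -Ah_ratcst.
have -> : \prod_(a < N) (u - (z a)%:A) = \prod_(a < N) Ah_coef h (ratXsubC (z a))%:MP.
  by apply: eq_bigr => a _; rewrite Ah_uB.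
have -> : u%:M - Z = diag_mx (\row_a Ah_coef h (ratXsubC (z a))%:MP).
  apply/matrixP => a b; rewrite !mxE -mulrnBl.
  by congr (_ *+ _); rewrite Ah_uB.
have -> : pu%:M - Lambda = diag_mx (\row_i (pu - Ah_coef h (Ah_cst R M N (lambda i)))).
  by apply/matrixP => i j; rewrite !mxE -mulrnBl coef.
have -> : G = \matrix_(i, j)
    ((pu - Ah_coef h (Ah_cst R M N (lambda i))) *+ (i == j)
     - \sum_(a < N) Ah_x h j a * Ah_p h i a * Ah_coef h (ratXsubC (z a))^-1%:MP).
  apply/matrixP => i j; rewrite [LHS]mxE [RHS]mxE coef.
  apply: (congr1 (fun t => _ - t)); apply: eq_bigr => a _.
  by rewrite [X _ _]mxE [P _ _]mxE.
exact: (rdet_schur (D := Ah_sys M N h) (fun a => ratXsubC_mulV M N (z a))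
  (fun k i => @Ah_der_cst R M N h k (lambda i)) (@der_pu_x R M N h)
  (fun a => der_pu_XsubCV M N h (z a)) (@der_p_x R M N h)
  (fun i a b => der_p_rat h i a (ratXsubC (z b))^-1)).
Qed.
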